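(* Let $R$ be a maximal subring of a ring $T$. Assume that $T$ has a nonzero ideal $I$ such that $R\cap I=0$. Then the following are equivalent: (1) $R$ is a prime ring and $l.ann_T(I)=0$. (2) $R$ is a prime ring and $r.ann_T(I)=0$. (3) $T$ is a prime ring and $I$ is a prime ideal of $T$. Moreover, if any of these equivalent conditions holds, then $(R:T)=(R:T)_l=(R:T)_r=0$.
   Context: All rings are associative and unital (not necessarily commutative), and subrings contain the identity of the big ring; ''ideal'' means two-sided ideal. A maximal subring $R$ of $T$ is a proper subring with no subring strictly between $R$ and $T$. Conductors: $(R:T)=\{x\in T: TxT\subseteq R\}$, $(R:T)_l=\{x\in T: Tx\subseteq R\}$, $(R:T)_r=\{x\in T: xT\subseteq R\}$. $l.ann_T(I)=\{t\in T: tI=0\}$, $r.ann_T(I)=\{t\in T: It=0\}$. *)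

(* Defs.v *)
From mathcomp Require Import all_boot all_order all_algebra.
From mathcomp Require Import boolp classical_sets.

Set Implicit Arguments.
Unset Strict Implicit.
Unset Printing Implicit Defensive.

Import GRing.Theory.
Local Open Scope classical_set_scope.
Local Open Scope ring_scope.

(* Subrings and ideals are Prop-valued subsets of an ambient ring T, which is
   neither assumed commutative nor nontrivial.  Ring-theoretic properties of a
   subring S are expressed relative to S inside T; the ring T itself is the
   case S = setT. *)

Definition subring (T : pzRingType) (S : set T) : Prop :=
  subring_closed [in S].

Definition maximal_subring (T : pzRingType) (R : set T) : Prop :=
  [/\ subring R, R <> setT &
      forall S : set T, subring S -> R `<=` S -> S = R \/ S = setT].

Definition ideal (T : pzRingType) (S A : set T) : Prop :=
  [/\ A `<=` S, zmod_closed [in A] &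
      forall s a, S s -> A a -> A (s * a) /\ A (a * s)].

(* The product AB consists of the finite sums of products, not only of the
   products themselves. *)
Definition ideal_mul (T : pzRingType) (A B : set T) : set T :=
  [set x | exists (n : nat) (a b : 'I_n -> T),
     [/\ forall i, A (a i), forall i, B (b i) & x = \sum_(i < n) a i * b i]].

Definition prime_ideal (T : pzRingType) (S P : set T) : Prop :=
  [/\ ideal S P, P <> S &
      forall A B : set T, ideal S A -> ideal S B ->
        ideal_mul A B `<=` P -> A `<=` P \/ B `<=` P].

(* As a prime ideal is proper, a prime ring is nonzero. *)
Definition prime_ring (T : pzRingType) (S : set T) : Prop :=
  prime_ideal S [set 0].

Definition lann (T : pzRingType) (I : set T) : set T :=
  [set t | forall x, I x -> t * x = 0].

Definition rann (T : pzRingType) (I : set T) : set T :=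
  [set t | forall x, I x -> x * t = 0].

(* Since R is closed under addition, it is immaterial whether TxT denotes the
   set of products s * x * t or the set of their finite sums. *)
Definition conductor (T : pzRingType) (R : set T) : set T :=
  [set x | forall s t, R (s * x * t)].

Definition lconductor (T : pzRingType) (R : set T) : set T :=
  [set x | forall t, R (t * x)].

Definition rconductor (T : pzRingType) (R : set T) : set T :=
  [set x | forall t, R (x * t)].

(* Main.v *)
(** Maximality forces [T = R + J] for every nonzero ideal [J] of [T] inside
    [I], so [I] is a minimal ideal with [T / I] isomorphic to [R]; hence [R]
    is prime iff [I] is.  If [lann I = 0] (or [rann I = 0]), a nonzero ideal of
    [T] meets [I] nontrivially, hence contains [I] by minimality; two nonzero
    ideals with product zero would give [I * I = 0], which is impossible.
    Conversely, annihilators of [I] vanish in a prime ring.  Finally, an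
    element of a conductor multiplies [I] into [R `&` I = 0] on one side. *)

Require Import Defs.
From mathcomp Require Import all_boot all_order all_algebra.
From mathcomp Require Import boolp classical_sets.

Set Implicit Arguments.
Unset Strict Implicit.
Unset Printing Implicit Defensive.

Import GRing.Theory.
Local Open Scope classical_set_scope.
Local Open Scope ring_scope.

(** * Elementwise forms of subrings, ideals and prime ideals *)

Section Ideals.
Variables (T : pzRingType) (S : set T).
Implicit Types A B P : set T.

Lemma subringP :
  subring S <->
  [/\ S 1, forall x y, S x -> S y -> S (x - y) &
      forall x y, S x -> S y -> S (x * y)].
Proof.
split=> -[S1 SB SM]; split; rewrite ?inE //.
- by rewrite inE in S1.
- by move=> x y Sx Sy; move: (SB x y); rewrite !inE; apply.
- by move=> x y Sx Sy; move: (SM x y); rewrite !inE; apply.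
- by move=> x y; rewrite !inE; apply: SB.
- by move=> x y; rewrite !inE; apply: SM.
Qed.

Lemma idealP A :
  ideal S A <->
  [/\ A `<=` S, A 0, forall x y, A x -> A y -> A (x - y) &
      forall s a, S s -> A a -> A (s * a) /\ A (a * s)].
Proof.
split=> [[AS [A0 AB] AM]|[AS A0 AB AM]].
  split=> [//||x y Ax Ay|//]; first by rewrite inE in A0.
  by move: (AB x y); rewrite !inE; apply.
by split=> //; split=> [|x y]; rewrite !inE //; apply: AB.
Qed.

Lemma idealD A x y : ideal S A -> A x -> A y -> A (x + y).
Proof.
move=> /idealP[_ A0 AB _] Ax Ay; rewrite -[y]opprK.
by apply: (AB) => //; rewrite -sub0r; apply: AB.
Qed.

(** Since [P] is closed under addition, single products decide the matter, so finite sums disappear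
    from the primeness condition. *)
Lemma ideal_mul_subP A B P : ideal S P ->
  ideal_mul A B `<=` P <-> (forall a b, A a -> B b -> P (a * b)).
Proof.
move=> hP; split=> [sub a b Aa Bb | ABP _ [n [a [b [Aa Bb ->]]]]].
  by apply: sub; exists 1%N, (fun=> a), (fun=> b); rewrite big_ord1; split.
elim/big_ind: _ => [|x y|i _]; first by case/idealP: hP.
- exact: idealD.
- exact: ABP.
Qed.

Lemma prime_idealP P :
  prime_ideal S P <->
  [/\ ideal S P, P <> S &
      forall A B, ideal S A -> ideal S B ->
        (forall a b, A a -> B b -> P (a * b)) -> A `<=` P \/ B `<=` P].
Proof.
split=> -[hP PS PP]; split=> // A B hA hB.
  by move=> /(ideal_mul_subP _ _ hP); apply: PP.
by move=> /(ideal_mul_subP _ _ hP); apply: PP.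
Qed.

Lemma ideal_eq0 A : ideal S A -> A `<=` [set 0] -> A = [set 0].
Proof. by move=> /idealP[_ A0 _ _] sA; apply/seteqP; split=> // x ->. Qed.

Lemma ideal_zero : subring S -> ideal S [set 0].
Proof.
move=> /subringP[S1 SB _]; apply/idealP; split=> //.
- by move=> _ ->; rewrite -(subrr 1); apply: SB.
- by move=> x y -> ->; rewrite /= subr0.
- by move=> s a _ ->; rewrite /= mulr0 mul0r.
Qed.

End Ideals.

(** * Annihilators of a two-sided ideal *)

Section Annihilators.
Variables (T : pzRingType) (I : set T).
Hypothesis hI : ideal setT I.

Lemma lann_ideal : ideal setT (lann I).
Proof.
case/idealP: hI => _ _ _ IM; apply/idealP; split=> //.
- by move=> x _; rewrite mul0r.
- by move=> x y lx ly z Iz; rewrite mulrBl lx // ly // subr0.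
- move=> s a _ la; split=> z Iz; first by rewrite -mulrA la // mulr0.
  by rewrite -mulrA; apply: la; case: (IM s z).
Qed.

Lemma rann_ideal : ideal setT (rann I).
Proof.
case/idealP: hI => _ _ _ IM; apply/idealP; split=> //.
- by move=> x _; rewrite mulr0.
- by move=> x y rx ry z Iz; rewrite mulrBr rx // ry // subr0.
- move=> s a _ ra; split=> z Iz; last by rewrite mulrA ra // mul0r.
  by rewrite mulrA; apply: ra; case: (IM s z).
Qed.

(** Both annihilators are ideals whose product with [I], on the proper side, is zero; primeness
    kills one factor, and it cannot be [I]. *)
Lemma prime_ring_ann0 : prime_ring [set: T] -> I <> [set 0] ->
  lann I = [set 0] /\ rann I = [set 0].
Proof.
move=> /prime_idealP[_ _ PT] I0.
have nI : ~ I `<=` [set 0] by move/(ideal_eq0 hI).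
split.
  apply: (ideal_eq0 lann_ideal).
  by have [] : lann I `<=` [set 0] \/ I `<=` [set 0]
    by apply: PT lann_ideal hI _ => a b; apply.
apply: (ideal_eq0 rann_ideal).
by have [] : I `<=` [set 0] \/ rann I `<=` [set 0]
  by apply: PT hI rann_ideal _ => a b Ia; apply.
Qed.

End Annihilators.

Definition sumset (T : pzRingType) (A B : set T) : set T :=
  [set x | exists a b, [/\ A a, B b & x = a + b]].

(** * A maximal subring and an ideal that meets it trivially *)

Section Complement.
Variables (T : pzRingType) (R I : set T).
Hypotheses (hR : maximal_subring R) (hI : ideal setT I) (hI0 : I <> [set 0]).
Hypothesis hRI : R `&` I = [set 0].

Let sR : subring R. Proof. by case: hR. Qed.

Let RI0 x : R x -> I x -> x = 0.
Proof. by move=> Rx Ix; have : (R `&` I) x by []; rewrite hRI. Qed.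

Lemma sumset_subring J : ideal setT J -> subring (sumset R J).
Proof.
have /subringP[R1 RB RM] := sR.
move=> hJ; have /idealP[_ J0 JB JM] := hJ; apply/subringP; split.
- by exists 1, 0; rewrite addr0.
- move=> _ _ [r [i [Rr Ji ->]]] [s [j [Rs Jj ->]]].
  exists (r - s), (i - j); split; [exact: RB|exact: JB|].
  by rewrite opprD addrACA.
- move=> _ _ [r [i [Rr Ji ->]]] [s [j [Rs Jj ->]]].
  exists (r * s), (r * j + i * (s + j)); split; first exact: RM.
    by apply: (idealD hJ); [case: (JM r j)|case: (JM (s + j) i)].
  by rewrite mulrDl mulrDr addrA.
Qed.

(** By maximality the subring [R + J] is [R] or everything; the first case would put [J] inside [R]
    and [I], hence make it zero. *)
Lemma sumset_eqT J : ideal setT J -> J <> [set 0] -> J `<=` I ->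
  forall x, sumset R J x.
Proof.
move=> hJ nJ JI x; have /idealP[_ J0 _ _] := hJ.
have R0 : R 0 by have /idealP[+ _ _ _] := ideal_zero sR; apply.
case: hR => _ _ /(_ _ (sumset_subring hJ)) [|eqR|->//].
  by move=> r Rr; exists r, 0; rewrite addr0.
case: nJ; apply: (ideal_eq0 hJ) => j Jj; apply: RI0; last exact: JI.
by rewrite -eqR; exists 0, j; rewrite add0r.
Qed.

(** Modular law: if [x = r + j] lies in [I], then [r = x - j] lies in both [R] and [I], so
    [x = j]. *)
Lemma minimal_ideal J : ideal setT J -> J <> [set 0] -> J `<=` I -> I `<=` J.
Proof.
move=> hJ J0 JI x Ix; have [r [j [Rr Jj Ex]]] := sumset_eqT hJ J0 JI x.
have /idealP[_ _ IB _] := hI.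
suff r0 : r = 0 by rewrite Ex r0 add0r.
by apply: RI0 => //; rewrite -(addrK j r) -Ex; apply: IB => //; apply: JI.
Qed.

Lemma decomposition x : exists r i, [/\ R r, I i & x = r + i].
Proof. exact: (sumset_eqT hI hI0). Qed.

(** This is the preimage of [A] under the projection of [T] onto [T / I], identified with [R]. A
    multiplier splits as [r + j]: [r] preserves [A], and every term involving [j] falls into [I]. *)
Lemma sumset_ideal A : ideal R A -> ideal setT (sumset A I).
Proof.
move=> /idealP[AR A0 AB AM]; have /idealP[_ I0 IB IM] := hI.
apply/idealP; split=> //.
- by exists 0, 0; rewrite addr0.
- move=> _ _ [a [i [Aa Ii ->]]] [b [j [Ab Ij ->]]].
  exists (a - b), (i - j); split; [exact: AB|exact: IB|].
  by rewrite opprD addrACA.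
- move=> s _ _ [a [i [Aa Ii ->]]].
  have [r [j [Rr Ij ->]]] := decomposition s.
  have [Ara Aar] := AM _ _ Rr Aa.
  have [I1 I2] := IM (r + j) i Logic.I Ii; have [I3 I4] := IM a j Logic.I Ij.
  split.
    exists (r * a), (j * a + (r + j) * i); split=> //; first exact: (idealD hI).
    by rewrite mulrDr mulrDl addrA.
  exists (a * r), (a * j + i * (r + j)); split=> //; first exact: (idealD hI).
  by rewrite mulrDl mulrDr addrA.
Qed.

(** This is the image of [A] in [T / I], identified with [R]. The intersection of [R] with [A] alone
    can be too small: it may vanish although [A] is not inside [I]. *)
Lemma trace_ideal A : ideal setT A -> ideal R (R `&` sumset A I).
Proof.
move=> hA; have /idealP[_ A0 AB AM] := hA; have /idealP[_ I0 IB IM] := hI.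
have /subringP[R1 RB RM] := sR.
apply/idealP; split; first by move=> x [].
- by split; [rewrite -(subrr 1); apply: RB|exists 0, 0; rewrite addr0].
- move=> x y [Rx [a [i [Aa Ii Ex]]]] [Ry [b [j [Ab Ij Ey]]]].
  split; first exact: RB.
  exists (a - b), (i - j); split; [exact: AB|exact: IB|].
  by rewrite Ex Ey opprD addrACA.
- move=> s x Rs [Rx [a [i [Aa Ii Ex]]]].
  have [A1 A2] := AM s a Logic.I Aa; have [I1 I2] := IM s i Logic.I Ii.
  split; (split; first exact: RM).
    by exists (s * a), (s * i); rewrite Ex mulrDr.
  by exists (a * s), (i * s); rewrite Ex mulrDl.
Qed.

Lemma prime_ring_compl : prime_ring R <-> prime_ideal setT I.
Proof.
have /subringP[R1 RB RM] := sR; have /idealP[_ I0 IB IM] := hI.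
have R0 : R 0 by rewrite -(subrr 1); apply: RB.
split=> /prime_idealP[hP PR PP]; apply/prime_idealP; split=> //.
- move=> IT; apply: PR; apply/seteqP; split=> [_ -> //|r Rr].
  by apply: RI0; rewrite ?IT.
- have mulI (A B : set T) : (forall a b, A a -> B b -> I (a * b)) ->
      forall x y, sumset A I x -> sumset B I y -> I (x * y).
    move=> ABI _ _ [a [i [Aa Ii ->]]] [b [j [Bb Ij ->]]].
    rewrite mulrDl mulrDr; apply: (idealD hI).
      by apply: (idealD hI); [exact: ABI|case: (IM a j)].
    by case: (IM (b + j) i).
  (* The [R]-component [a - i] of an element [a] of [A] lies in the trace of [A]; if it vanishes,
     then [a = i] is in [I]. *)
  have subI (A : set T) : R `&` sumset A I `<=` [set 0] -> A `<=` I.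
    move=> A0 a Aa; have [r [i [Rr Ii Ea]]] := decomposition a.
    have NIi : I (- i) by rewrite -sub0r; apply: IB.
    suff r0 : r = 0 by rewrite Ea r0 add0r.
    by apply: A0; split=> //; exists a, (- i); rewrite Ea addrK -Ea.
  move=> A B hA hB ABI.
  have [x y [Rx Ax] [Ry By]||] :=
      PP _ _ (trace_ideal hA) (trace_ideal hB).
  + by apply: RI0; [exact: RM|exact: mulI Ax By].
  + by left; apply: subI.
  + by right; apply: subI.
- exact: ideal_zero.
(* If [R] were zero, then [1 = 0], so [T] would be trivial and [I] not proper. *)
- move=> R00; apply: PR; apply/seteqP; split=> // x _.
  have : [set 0] (1 : T) by rewrite R00.
  by move=> /= T0; rewrite -[x]mul1r T0 mul0r.
- have sub0 A : ideal R A -> sumset A I `<=` I -> A `<=` [set 0].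
    move=> /idealP[AR _ _ _] sA a Aa; apply: RI0; first exact: AR.
    by apply: sA; exists a, 0; rewrite addr0.
  move=> A B hA hB AB0.
  have [_ _ [a [i [Aa Ii ->]]] [b [j [Bb Ij ->]]]||] :=
      PP _ _ (sumset_ideal hA) (sumset_ideal hB).
  + rewrite mulrDl mulrDr (AB0 a b) // add0r.
    by apply: (idealD hI); [case: (IM a j)|case: (IM (b + j) i)].
  + by left; apply: sub0.
  + by right; apply: sub0.
Qed.

Lemma ann0_prime_ring :
  lann I = [set 0] \/ rann I = [set 0] -> prime_ring [set: T].
Proof.
have /idealP[_ I0 IB IM] := hI => ann0.
have nI : ~ I `<=` [set 0] by move/(ideal_eq0 hI).
have sub_nz A : ideal setT A -> ~ A `<=` [set 0] -> I `<=` A.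
  move=> hA nA; have /idealP[_ A0 AB AM] := hA.
  have hAI : ideal setT (A `&` I).
    apply/idealP; split=> //.
    - by move=> x y [Ax Ix] [Ay Iy]; split; [exact: AB|exact: IB].
    - move=> s a _ [Aa Ia]; have [A1 A2] := AM s a Logic.I Aa.
      by have [I1 I2] := IM s a Logic.I Ia.
  (* If [A] met [I] trivially, the products of [A] and [I] in either order, lying in both ideals,
     would vanish; [A] would then lie in both annihilators of [I], one of which is zero. *)
  have AI0 : A `&` I <> [set 0].
    move=> AI0; apply: nA => a Aa.
    have eq0 x : A x -> I x -> x = 0.
      by move=> Ax Ix; have : (A `&` I) x by []; rewrite AI0.
    case: ann0 => <- x Ix; have [A1 A2] := AM x a Logic.I Aa;
      by have [I1 I2] := IM a x Logic.I Ix; apply: eq0.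
  have sAI : A `&` I `<=` I by move=> x [].
  by move=> x Ix; case: (minimal_ideal hAI AI0 sAI Ix).
apply/prime_idealP; split.
- by apply: ideal_zero; apply/subringP; split.
- by move=> T0; apply: nI; rewrite T0.
- move=> A B hA hB AB0.
  have [?|/(sub_nz _ hA) IA] := pselect (A `<=` [set 0]); first by left.
  have [?|/(sub_nz _ hB) IB'] := pselect (B `<=` [set 0]); first by right.
  (* Both [A] and [B] contain [I], so [I] squares to zero and lies in its own left and right
     annihilators. *)
  case: nI => x Ix; case: ann0 => <- y Iy.
    by apply: AB0; [exact: IA|exact: IB'].
  by apply: AB0; [exact: IA|exact: IB'].
Qed.

(** The sides cross over: the left conductor is absorbed by [rann I], the right one by [lann I]. The
    two-sided conductor reduces to the right one by taking [s = 1]. *)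
Lemma conductors0 : lann I = [set 0] -> rann I = [set 0] ->
  [/\ conductor R = [set 0], lconductor R = [set 0] & rconductor R = [set 0]].
Proof.
move=> l0 r0; have /idealP[_ _ _ IM] := hI.
have R0 : R 0 by have /idealP[+ _ _ _] := ideal_zero sR; apply.
split; apply/seteqP; split=> x.
- move=> cx; rewrite -l0 => i Ii; apply: RI0; last by case: (IM x i).
  by have := cx 1 i; rewrite mul1r.
- by move=> -> s t; rewrite mulr0 mul0r.
- move=> cx; rewrite -r0 => i Ii; apply: RI0; first exact: cx.
  by case: (IM x i).
- by move=> -> t; rewrite mulr0.
- move=> cx; rewrite -l0 => i Ii; apply: RI0; first exact: cx.
  by case: (IM x i).
- by move=> -> t; rewrite mul0r.
Qed.

End Complement.

Theorem proposition2p2 (T : pzRingType) (R I : set T)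
    (hR : maximal_subring R)
    (hI : ideal setT I) (hI0 : I <> [set 0])
    (hRI : R `&` I = [set 0]) :
  let c1 := prime_ring R /\ lann I = [set 0] in
  let c2 := prime_ring R /\ rann I = [set 0] in
  let c3 := prime_ring [set: T] /\ prime_ideal setT I in
  [/\ c1 <-> c2, c2 <-> c3 &
      c1 \/ c2 \/ c3 ->
      [/\ conductor R = [set 0],
          lconductor R = [set 0] &
          rconductor R = [set 0]]].
Proof.
move=> c1 c2 c3.
have ann0 := prime_ring_ann0 hI ^~ hI0.
have primeRI := prime_ring_compl hR hI hI0 hRI.
have primeT := ann0_prime_ring hR hI hI0 hRI.
(* The left and right conditions are compared only through [c3], which makes both annihilators
   vanish at once. *)
have c13 : c1 -> c3.
  by move=> [/primeRI PI l0]; split=> //; apply: primeT; left.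
have c23 : c2 -> c3.
  by move=> [/primeRI PI r0]; split=> //; apply: primeT; right.
have c31 : c3 -> c1 by move=> [/ann0[l0 _] /primeRI].
have c32 : c3 -> c2 by move=> [/ann0[_ r0] /primeRI].
split; [by split=> [/c13/c32|/c23/c31]|by split|].
move=> h; have [/ann0[l0 r0] _] : c3 by case: h => [/c13|[/c23|]].
exact: conductors0 hR hI hRI l0 r0.
Qed.
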